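(* Let $T\ge 0$ be an integer, let $1\le k<n$ and $m \ge 0$ be integers, let $q$ be a prime power, and consider any time-invariant linear $(n,k,m)$ convolutional code over $\mathbb{F}_q$, of rate $R=k/n$. Let $d_T$ be its column distance and $c_T$ its column span. Then $$\left(\frac{R}{1-R}\right)c_T + d_T \le T + 1 + \frac{1}{1-R},$$ and moreover $d_T \le c_T$ and $c_T \le T+1$.
   Context: A time-invariant linear $(n,k,m)$ convolutional code over $\mathbb{F}_q$ is given by matrices $\mathbf{G}_0,\dots,\mathbf{G}_m\in\mathbb{F}_q^{k\times n}$ (set $\mathbf{G}_j=0$ for $j>m$). It maps source packets $\mathbf{s}_i\in\mathbb{F}_q^k$ (row vectors, $i\ge 0$, with $\mathbf{s}_i=0$ for $i<0$) to channel packets $\mathbf{x}_i=\sum_{j=0}^m \mathbf{s}_{i-j}\mathbf{G}_j\in\mathbb{F}_q^n$. Its rate is $R=k/n$. The first $T+1$ channel packets are $[\mathbf{x}_0,\dots,\mathbf{x}_T]=[\mathbf{s}_0,\dots,\mathbf{s}_T]\,\mathbf{G}^s_T$, where $\mathbf{G}^s_T$ is the block upper-triangular matrix whose block in block-row $i$ and block-column $j$ ($0\le i,j\le T$) is $\mathbf{G}_{j-i}$ if $j\ge i$ and $0$ otherwise. For a sequence $\mathbf{x}=[\mathbf{x}_0,\dots,\mathbf{x}_T]$ with $\mathbf{x}_i\in\mathbb{F}_q^n$, weight and span are counted at the level of packets: - $\mathrm{wt}(\mathbf{x})$ is the number of indices $i\in\{0,\dots,T\}$ with $\mathbf{x}_i\ne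 0$; - $\mathrm{span}(\mathbf{x})=j-i+1$, where $i$ is the first and $j$ the last index with a nonzero packet (and $\mathrm{span}(0)=0$). The column distance is $d_T=\min \mathrm{wt}(\mathbf{s}\,\mathbf{G}^s_T)$ and the column span is $c_T=\min\mathrm{span}(\mathbf{s}\,\mathbf{G}^s_T)$, both minima being over all $\mathbf{s}=[\mathbf{s}_0,\dots,\mathbf{s}_T]$ with $\mathbf{s}_i\in\mathbb{F}_q^k$ and $\mathbf{s}_0\neq 0$. *)

(* Defs.v *)
From HB Require Import structures.
From mathcomp Require Import all_boot all_order all_algebra.

Set Implicit Arguments.
Unset Strict Implicit.
Unset Printing Implicit Defensive.

Import GRing.Theory.
Local Open Scope ring_scope.

Definition conv_code (F : finFieldType) (n k m : nat) : Type :=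
  'I_m.+1 -> 'M[F]_(k, n).

(* G_j for every j : nat, with the convention G_j = 0 for j > m. *)
Definition code_coef (F : finFieldType) (n k m : nat) (G : conv_code F n k m)
    (j : nat) : 'M[F]_(k, n) :=
  if insub j is Some i then G i else 0.

Definition rate (n k : nat) : rat := k%:R / n%:R.

(* A sequence of T + 1 packets [p_0, ..., p_T] of length l is a row vector of
   T + 1 blocks of length l; its i-th packet is [packet x i]. *)
Notation packet_seq F l T := ('rV[F]_(\sum_(i < T.+1) l)).

Definition packet (F : finFieldType) (l T : nat) (x : packet_seq F l T)
    (i : 'I_T.+1) : 'rV[F]_l :=
  @submxrow F T.+1 (fun=> l) 1 x i.

Definition truncated_generator (F : finFieldType) (n k m : nat)
    (G : conv_code F n k m) (T : nat) :
    'M[F]_(\sum_(i < T.+1) k, \sum_(j < T.+1) n) :=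
  @mxblock F T.+1 T.+1 (fun=> k) (fun=> n)
    (fun i j => if (i <= j)%N then code_coef G (j - i)%N else 0).

Definition packet_wt (F : finFieldType) (n T : nat)
    (x : packet_seq F n T) : nat :=
  #|[set i : 'I_T.+1 | packet x i != 0]|.

Definition packet_span (F : finFieldType) (n T : nat)
    (x : packet_seq F n T) : nat :=
  if [pick i : 'I_T.+1 | packet x i != 0] is Some i0 then
    let first := [arg min_(i < i0 | packet x i != 0) (i : nat)] in
    let last := [arg max_(j > i0 | packet x j != 0) (j : nat)] in
    (last - first + 1)%N
  else 0%N.

(* Minimum of f (s G^s_T) over the source sequences s with s_0 != 0. The
   all-ones sequence only serves as a witness that such an s exists, which it
   is for k >= 1; see [column_minP]. *)
Definition column_min (F : finFieldType) (n k m : nat) (G : conv_code F n k m)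
    (T : nat) (f : packet_seq F n T -> nat) : nat :=
  let h (s : packet_seq F k T) := f (s *m truncated_generator G T) in
  h [arg min_(s < const_mx 1 | packet s ord0 != 0) h s].

Definition column_distance (F : finFieldType) (n k m : nat)
    (G : conv_code F n k m) (T : nat) : nat := column_min G (@packet_wt F n T).

Definition column_span (F : finFieldType) (n k m : nat)
    (G : conv_code F n k m) (T : nat) : nat := column_min G (@packet_span F n T).

Lemma column_minP (F : finFieldType) (n k m : nat) (G : conv_code F n k m)
    (T : nat) (f : packet_seq F n T -> nat) : (0 < k)%N ->
  (exists2 s : packet_seq F k T, packet s ord0 != 0 &
     f (s *m truncated_generator G T) = column_min G f) /\
  (forall s : packet_seq F k T, packet s ord0 != 0 ->
     (column_min G f <= f (s *m truncated_generator G T))%N).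
Proof.
move=> k_gt0; rewrite /column_min.
case: arg_minnP => [|s s0 s_min]; last by split=> //; exists s.
apply/eqP => /rowP /(_ (Ordinal k_gt0)); rewrite !mxE => /eqP.
by rewrite oner_eq0.
Qed.

(* Main.v *)
(* Put B = c - 1, N = d - 1 and M = T + 1 - N, and consider the channel that
   periodically erases B packets and then delivers M packets. Every window of
   T + 1 packets contains either a single burst of at most B erasures or at most
   N erasures, so each source packet is recovered with delay T. Counting the
   source symbols against the delivered ones over many periods gives
   k (B + M) <= n M, which is the bound, since 1 + R / (1 - R) = 1 / (1 - R). *)
Require Import Defs.
From HB Require Import structures.
From mathcomp Require Import all_boot all_order all_algebra.
From mathcomp Require Import zify.

Set Implicit Arguments.
Unset Strict Implicit.
Unset Printing Implicit Defensive.

Import Order.TTheory GRing.Theory Num.Theory.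
Local Open Scope ring_scope.

Lemma packet_span_le (F : finFieldType) (n T : nat) (x : packet_seq F n T)
    (a b : nat) :
  (forall i : 'I_T.+1, packet x i != 0 -> (a <= i < a + b)%N) ->
  (packet_span x <= b)%N.
Proof.
move=> supp; rewrite /packet_span; case: pickP => [i0 xi0|//].
case: arg_minnP => // i xi _; case: arg_maxnP => // j xj _.
by have := supp _ xi; have := supp _ xj; lia.
Qed.

Lemma packet_wt_le_span (F : finFieldType) (n T : nat) (x : packet_seq F n T) :
  (packet_wt x <= packet_span x)%N.
Proof.
rewrite /packet_wt /packet_span; case: pickP => [i0 xi0|x0]; last first.
  by rewrite leqn0 cards_eq0; apply/eqP/setP => i; rewrite !inE x0.
case: arg_minnP => // i xi i_min; case: arg_maxnP => // j xj j_max.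
rewrite addn1 -[X in (_ <= X)%N]card_ord.
(* Shifting by the first index [i] is faithful on the support, where [l - i <= j - i]; elsewhere the
   truncated [-] and the default of [inord] may merge indices, so injectivity is claimed on the
   support only. *)
pose f (l : 'I_T.+1) : 'I_(j - i).+1 := inord (l - i).
suff f_inj : {in [set l | packet x l != 0] &, injective f}.
  by rewrite -(card_in_imset f_inj) max_card.
move=> a b; rewrite !inE => xa xb /(congr1 val).
have := i_min a xa; have := i_min b xb; have := j_max a xa; have := j_max b xb.
move=> /= leb lea ib ia; rewrite !inordK; try lia.
by move=> eq_ab; apply: val_inj => /=; lia.
Qed.

(** Let [r] be the phase of [i]. If [r + N <= B], the window ends within the current period and
    meets only the tail of its burst. If [B - N < r < B], it contains a full run of [M] deliveries.
    If [B <= r], it starts among deliveries, and [N <= B] makes it end before a second burst. *)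
Lemma periodic_erasure_window (B M N T i : nat) :
  (N <= B)%N -> (0 < M)%N -> (M + N = T.+1)%N ->
  (exists a, forall j, (j <= T)%N -> ((i + j) %% (B + M) < B)%N ->
     (a <= j < a + B)%N) \/
  (exists2 a, (a + M <= T.+1)%N & forall j, (a <= j < a + M)%N ->
     (B <= (i + j) %% (B + M))%N).
Proof.
move=> leNB M_gt0 eqT; set P := (B + M)%N.
have P_gt0 : (0 < P)%N by lia.
set r := (i %% P)%N; have ltrP : (r < P)%N by rewrite ltn_mod.
have modE j : ((i + j) %% P = (r + j) %% P)%N by rewrite modnDml.
have mod_lo j : (r + j < P)%N -> ((i + j) %% P = r + j)%N.
  by move=> ?; rewrite modE modn_small.
have mod_hi j : (P <= r + j < P + P)%N -> ((i + j) %% P = r + j - P)%N.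
  move=> /andP[leP ltPP]; rewrite modE -{1}(subnK leP) modnDr modn_small //.
  lia.
have [ler|ltr] := leqP (r + N) B.
  left; exists 0%N => j lejT; rewrite mod_lo; lia.
have [ltrB|leBr] := ltnP r B.
  right; exists (B - r)%N => [|j]; first lia.
  move=> ?; rewrite mod_lo; lia.
left; exists (P - r)%N => j lejT.
have [lo|hi] := ltnP (r + j) P; first by rewrite mod_lo //; lia.
rewrite mod_hi; lia.
Qed.

Lemma packet_wt_le_gap (F : finFieldType) (n T : nat) (x : packet_seq F n T)
    (a M : nat) :
  (a + M <= T.+1)%N ->
  (forall i : 'I_T.+1, (a <= i < a + M)%N -> packet x i = 0) ->
  (packet_wt x + M <= T.+1)%N.
Proof.
move=> leaM gap; pose f (i : 'I_M) : 'I_T.+1 := inord (a + i).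
have fE i : f i = (a + i)%N :> nat by rewrite inordK //; have := ltn_ord i; lia.
have f_inj : injective f.
  by move=> i j /(congr1 val) /=; rewrite !fE => /addnI /val_inj.
rewrite -[X in (_ <= X)%N]card_ord -(cardsC [set i | packet x i != 0]).
rewrite leq_add2l -[X in (X <= _)%N]card_ord -(card_imset _ f_inj).
apply/subset_leq_card/subsetP => _ /imsetP[i _ ->]; rewrite !inE negbK.
by rewrite gap // fE; have := ltn_ord i; lia.
Qed.

(** The untruncated channel stream. Summing over all [j <= i] respects the memory [m] because
    [code_coef] vanishes beyond it. *)
Definition encode (F : finFieldType) (n k m : nat) (G : conv_code F n k m)
    (s : nat -> 'rV[F]_k) (i : nat) : 'rV[F]_n :=
  \sum_(j < i.+1) s j *m code_coef G (i - j).

Lemma encodeB (F : finFieldType) (n k m : nat) (G : conv_code F n k m)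
    (s t : nat -> 'rV[F]_k) (i : nat) :
  encode G (fun j => s j - t j) i = encode G s i - encode G t i.
Proof.
by rewrite /encode -sumrB; apply: eq_bigr => j _; rewrite mulmxBl.
Qed.

(* This is where the time invariance of the code enters. *)
Lemma packet_truncated_generator (F : finFieldType) (n k m T : nat)
    (G : conv_code F n k m) (s : nat -> 'rV[F]_k) (i : nat) (j : 'I_T.+1) :
  (forall l, (l < i)%N -> s l = 0) ->
  packet ((\mxrow_(l < T.+1) s (i + l)%N) *m truncated_generator G T) j =
  encode G s (i + j).
Proof.
move=> s0; rewrite /packet /truncated_generator mul_mxrow_mxblock mxrowK.
pose f l := s (i + l)%N *m code_coef G (j - l).
transitivity (\sum_(0 <= l < j.+1) f l).
  rewrite big_mkord (big_ord_widen T.+1 f (ltn_ord j)) [RHS]big_mkcond /=.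
  apply: eq_bigr => l _; rewrite ltnS /f; case: ifP => // _.
  by rewrite mulmx0.
rewrite /encode -(big_mkord xpredT (fun l => s l *m code_coef G (i + j - l))).
rewrite [RHS](big_cat_nat (leq0n i)) /=; last lia.
rewrite [in RHS]big_nat [X in _ = X + _]big1 ?add0r => [|l ltli]; last first.
  by rewrite s0 ?mul0mx.
rewrite -{1}[i]add0n [in RHS]big_addn (_ : (i + j).+1 - i = j.+1)%N; last lia.
by apply: eq_bigr => l _; rewrite /f (addnC l) subnDl.
Qed.

(* A source whose first nonzero packet is [s_i] produces, in the window
   [i, i + T], a truncated codeword of weight at least [d] and of span at least
   [c], which the erasures of the window cannot hide. *)
Lemma periodic_erasure_decodable (F : finFieldType) (n k m T B N M : nat)
    (G : conv_code F n k m) (s : nat -> 'rV[F]_k) (H : nat) :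
  (0 < k)%N -> (0 < M)%N -> (N <= B)%N -> (M + N = T.+1)%N ->
  (N < column_distance G T)%N -> (B < column_span G T)%N ->
  (forall i, (i < H + T)%N -> (B <= i %% (B + M))%N -> encode G s i = 0) ->
  forall i, (i < H)%N -> s i = 0.
Proof.
move=> k_gt0 M_gt0 leNB eqT ltNd ltBc recv.
elim/ltn_ind => i IH ltiH; apply/eqP/negP => /negP si.
have s0 l : (l < i)%N -> s l = 0 by move=> ltli; apply: IH => //; lia.
set u : packet_seq F k T := \mxrow_(l < T.+1) s (i + l)%N.
have u0 : packet u ord0 != 0 by rewrite /packet mxrowK addn0.
have led := (column_minP G (@packet_wt F n T) k_gt0).2 u u0.
have lec := (column_minP G (@packet_span F n T) k_gt0).2 u u0.
have delivered (j : 'I_T.+1) : (B <= (i + j) %% (B + M))%N ->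
    packet (u *m truncated_generator G T) j = 0.
  move=> ?; rewrite packet_truncated_generator // recv //.
  by have := ltn_ord j; lia.
have [[a burst]|[a leaM gap]] := periodic_erasure_window i leNB M_gt0 eqT.
  suff : (packet_span (u *m truncated_generator G T) <= B)%N.
    by move: ltBc lec; rewrite /column_span; lia.
  apply: (@packet_span_le _ _ _ _ a) => j xj; apply: burst.
    by rewrite -ltnS ltn_ord.
  by rewrite ltnNge; apply: contra xj => /delivered ->.
suff : (packet_wt (u *m truncated_generator G T) + M <= T.+1)%N.
  by move: ltNd led; rewrite /column_distance; lia.
apply: (packet_wt_le_gap leaM) => j /gap; exact: delivered.
Qed.

(** By linearity, two zero-padded sources with the same deliveries differ by a source whose
    deliveries all vanish, hence they agree. The map from sources to deliveries is thus injective,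
    and comparing cardinalities compares exponents of [#|F|]. *)
Lemma periodic_erasure_count (F : finFieldType) (n k m T B N M L : nat)
    (G : conv_code F n k m) :
  (0 < k)%N -> (0 < M)%N -> (N <= B)%N -> (M + N = T.+1)%N ->
  (N < column_distance G T)%N -> (B < column_span G T)%N ->
  (k * (L * (B + M)) <= n * ((L + T) * M))%N.
Proof.
move=> k_gt0 M_gt0 leNB eqT ltNd ltBc; set P := (B + M)%N.
pose src (s : {ffun 'I_(L * P) -> 'rV[F]_k}) (i : nat) : 'rV[F]_k :=
  if insub i is Some i' then s i' else 0.
(* [p.1] is the period and [p.2] the position in its run of deliveries, which follows [B]
   erasures. *)
pose recv s : {ffun 'I_(L + T) * 'I_M -> 'rV[F]_n} :=
  [ffun p : 'I_(L + T) * 'I_M => encode G (src s) (p.1 * P + B + p.2)%N].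
have recv_inj : injective recv.
  move=> s t /ffunP eq_st; apply/ffunP => i.
  have srcE u : src u i = u i by rewrite /src valK.
  apply/eqP; rewrite -subr_eq0 -!srcE; apply/eqP.
  apply: (@periodic_erasure_decodable _ _ _ _ _ _ _ _ G
    (fun j => src s j - src t j) (L * P)
    k_gt0 M_gt0 leNB eqT ltNd ltBc) => // j ltj lej.
  rewrite encodeB; apply/eqP; rewrite subr_eq0; apply/eqP.
  have ltjP : (j %% P < P)%N by rewrite ltn_mod; lia.
  have lt1 : (j %/ P < L + T)%N.
    rewrite ltn_divLR; last lia.
    (* The [T] packets of decoding delay fit in [T] further periods, since [P >= 1]. *)
    by apply: (leq_trans ltj); rewrite mulnDl leq_add2l leq_pmulr //; lia.
  have lt2 : (j %% P - B < M)%N by move: ltjP; rewrite /P; lia.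
  have := eq_st (Ordinal lt1, Ordinal lt2); rewrite !ffunE /=.
  by rewrite -addnA subnKC // -divn_eq.
have := leq_card _ recv_inj.
rewrite !card_ffun !card_mx card_prod !card_ord !mul1n -!expnM.
by rewrite leq_exp2l // card_finNzRing_gt1.
Qed.

Lemma column_distance_le_span (F : finFieldType) (n k m T : nat)
    (G : conv_code F n k m) :
  (0 < k)%N -> (column_distance G T <= column_span G T)%N.
Proof.
move=> k_gt0; rewrite /column_span.
have [[s s0 <-] _] := column_minP G (@packet_span F n T) k_gt0.
apply: leq_trans (packet_wt_le_span _).
exact: (column_minP G (@packet_wt F n T) k_gt0).2.
Qed.

Lemma column_span_le (F : finFieldType) (n k m T : nat)
    (G : conv_code F n k m) : (0 < k)%N -> (column_span G T <= T.+1)%N.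
Proof.
move=> k_gt0; rewrite /column_span.
have [[s s0 <-] _] := column_minP G (@packet_span F n T) k_gt0.
by apply: (@packet_span_le _ _ _ _ 0) => i _; rewrite ltn_ord.
Qed.

(** Handles the degenerate case in which [d - 1] would be negative: a codeword of weight 0 is zero,
    so it has span 0. *)
Lemma column_span_eq0 (F : finFieldType) (n k m T : nat)
    (G : conv_code F n k m) :
  (0 < k)%N -> column_distance G T = 0%N -> column_span G T = 0%N.
Proof.
move=> k_gt0; rewrite /column_distance /column_span.
have [[s s0 <-] _] := column_minP G (@packet_wt F n T) k_gt0.
move=> /eqP; rewrite cards_eq0 => /eqP/setP wt0; apply/eqP; rewrite -leqn0.
apply: leq_trans ((column_minP G (@packet_span F n T) k_gt0).2 s s0) _.
by apply: (@packet_span_le _ _ _ _ 0) => i xi; have := wt0 i; rewrite !inE xi.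
Qed.

(** The rational bound multiplied by [n - k], as [R / (1 - R) = k / (n - k)] and
    [1 / (1 - R) = n / (n - k)]. *)
Lemma column_span_distance_bound (F : finFieldType) (n k m T : nat)
    (G : conv_code F n k m) : (0 < k)%N -> (k <= n)%N ->
  (k * column_span G T + (n - k) * column_distance G T
     <= (n - k) * T.+1 + n)%N.
Proof.
move=> k_gt0 lekn.
have := column_distance_le_span T G k_gt0; have := column_span_le T G k_gt0.
have [d0|d_gt0] := posnP (column_distance G T).
  by rewrite (column_span_eq0 k_gt0 d0) d0 !muln0.
have count L := @periodic_erasure_count F n k m T (column_span G T).-1
  (column_distance G T).-1 (T.+1 - (column_distance G T).-1) L G k_gt0.
move: d_gt0 count; set d := column_distance G T; set c := column_span G T.
move=> d_gt0 count lecT ledc.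
set M := (T.+1 - d.-1)%N in count; set P := (c.-1 + M)%N in count.
have {}count L : (k * (L * P) <= n * ((L + T) * M))%N.
  by apply: count; rewrite /M; lia.
(* The [T] extra periods are negligible when the number of periods is large. *)
have : (k * P <= n * M)%N.
  rewrite leqNgt; apply/negP => lt.
  (* If [n * M + 1 <= k * P], then [count L] forces [L <= n * M * T]. *)
  have := count (n * M * T).+1; nia.
(* Here [M = T + 2 - d], so the inequality reads [k (c - 1) <= (n - k) (T + 2 - d)]; the constants
   [k] and [n - k] add up to [n]. *)
rewrite /P /M; nia.
Qed.

Theorem theorem1 (F : finFieldType) (n k m T : nat)
    (hk : (1 <= k)%N) (hkn : (k < n)%N) (G : conv_code F n k m) :
  let R := rate n k in
  let d := column_distance G T in
  let c := column_span G T in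
  [/\ R / (1 - R) * c%:R + d%:R <= T%:R + 1 + 1 / (1 - R),
      (d <= c)%N
    & (c <= T.+1)%N].
Proof.
move=> R d c; split; last exact: column_span_le.
- have n_gt0 : (0 : rat) < n%:R by rewrite ltr0n; lia.
  have nk_gt0 : (0 : rat) < (n - k)%:R by rewrite ltr0n subn_gt0.
  have eqR : 1 - R = (n - k)%:R / n%:R.
    by rewrite /R /rate natrB 1?ltnW // mulrBl divff ?gt_eqF.
  have eqR1 : R / (1 - R) = k%:R / (n - k)%:R.
    by rewrite eqR /R /rate invf_div mulrA divfK ?gt_eqF.
  rewrite eqR1 eqR div1r invf_div natr1 -(ler_pM2r nk_gt0) !mulrDl.
  rewrite divfK ?gt_eqF // mulrAC divfK ?gt_eqF // -!natrM -!natrD ler_nat.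
  have := column_span_distance_bound T G hk (ltnW hkn); rewrite -/c -/d; lia.
- exact: column_distance_le_span.
Qed.
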